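(* Let $m$ be an odd positive integer and $d \geq 2$ an integer. Then $\beta_{2m}(d) \geq 2\,\beta_{\{2,4,\ldots,2m\}}(d-1)$. Moreover, if $b$ is an even integer with $m < b \leq \beta_{\{2,4,\ldots,2m\}}(d-1)$, then $\beta_{2b-2m}(d) \geq 2b$.
   Context: For a set $W$ of positive integers containing at least one even number, $\beta_W(d)$ denotes the largest size of a set $A \subseteq \mathbb{Z}_2^d$ (of distinct elements) which has no subset $B \subseteq A$ with $|B| \in W$ and $\sum_{x\in B} x = 0$. For a positive integer $k$, $\beta_{2k}(d) = \beta_{\{2k\}}(d)$. *)

(* Defs.v *)
From HB Require Import structures.
From mathcomp Require Import all_boot all_order all_algebra.

Set Implicit Arguments.
Unset Strict Implicit.
Unset Printing Implicit Defensive.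

Import GRing.Theory.

Definition zero_sum_free (W : {pred nat}) (d : nat) (A : {set 'rV['Z_2]_d}) : bool :=
  [forall B : {set 'rV['Z_2]_d},
     (B \subset A) && (#|B| \in W) ==> (\sum_(x in B) x != 0)%R].

(* Meant for sets W of positive integers: then the empty set is always
   admissible and the maximum ranges over a nonempty family. (If 0 \in W, no
   set is admissible and the value is the default 0.) *)
Definition beta (W : {pred nat}) (d : nat) : nat :=
  \max_(A : {set 'rV['Z_2]_d} | zero_sum_free W A) #|A|.

Definition evens_upto (m : nat) : {pred nat} :=
  [pred k | [&& 0 < k, ~~ odd k & k <= 2 * m]].

(* Main.v *)
(** Given [A] in Z_2^(d-1) without zero-sum subsets of size 2, 4, ..., 2m, take
    the two-layer set [A * {0,1}] in Z_2^d.  If a subset [B] of it has layers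
    [B0], [B1], the elements in exactly one layer form a set [T] of size
    [|B| - 2 |B0 :&: B1|] with the same sum as [B] on the first d-1 coordinates.
    If [|B| = 2m] and [B] has sum zero, then [|T|] is even and at most 2m, so
    [T] is empty, [B0 = B1] has size m, and the remaining coordinate of the sum
    of [B] is [m = 1] in Z_2, a contradiction.
    If [|A| = b] is even, the whole of [A * {0,1}] has sum zero, so that
    complementation exchanges zero-sum subsets of sizes 2m and 2b - 2m. *)
Require Import Defs.
From HB Require Import structures.
From mathcomp Require Import all_boot all_order all_algebra.
From mathcomp Require Import zify.

Set Implicit Arguments.
Unset Strict Implicit.
Unset Printing Implicit Defensive.

Import GRing.Theory.

Lemma addZ2rr n (x : 'rV['Z_2]_n) : (x + x = 0)%R.
Proof.
apply/rowP => i; rewrite !mxE.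
by case: (x _ i) => [[|[|k]] lt_k2] //; apply: val_inj.
Qed.

Lemma natr_Z2 k : (k%:R = (odd k)%:R :> 'Z_2)%R.
Proof. by apply: val_inj; rewrite /= !val_Zp_nat // !modn2 oddb. Qed.

(** Each element common to [A] and [B] is counted twice on the right and cancels, as [x + x = 0]. *)
Lemma sum_symmdiffZ2 n (A B : {set 'rV['Z_2]_n}) :
  (\sum_(x in A :\: B :|: B :\: A) x = \sum_(x in A) x + \sum_(x in B) x)%R.
Proof.
rewrite [LHS](big_setID A) /=.
have -> : (A :\: B :|: B :\: A) :&: A = A :\: B.
  by apply/setP => x; rewrite !inE; case: (x \in A); rewrite ?andbF ?andbT ?orbF.
have -> : (A :\: B :|: B :\: A) :\: A = B :\: A.
  by apply/setP => x; rewrite !inE; case: (x \in A); rewrite ?andbF.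
rewrite [X in (_ = X + _)%R](big_setID B) [X in (_ = _ + X)%R](big_setID A) /=.
by rewrite [B :&: A]setIC addrACA addZ2rr add0r.
Qed.

(** The additive form avoids truncated subtraction and yields both the parity and the bound for the
    symmetric difference. *)
Lemma card_symmdiff (T : finType) (A B : {set T}) :
  #|A :\: B :|: B :\: A| + 2 * #|A :&: B| = #|A| + #|B|.
Proof.
rewrite -(cardsID B A) -(cardsID A B) [B :&: A]setIC cardsU.
have -> : (A :\: B) :&: (B :\: A) = set0.
  by apply/setP => x; rewrite !inE; case: (x \in A); case: (x \in B).
by rewrite cards0; lia.
Qed.

Section Layers.
Variable n : nat.

Definition layer (c : 'Z_2) (B : {set 'rV['Z_2]_(1 + n)}) : {set 'rV['Z_2]_n} :=
  [set x | row_mx c%:M x \in B].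

Definition two_layers (A : {set 'rV['Z_2]_n}) : {set 'rV['Z_2]_(1 + n)} :=
  [set v | rsubmx v \in A].

(** Stated for any commutative law so as to serve both cardinalities and vector sums. *)
Lemma big_layers (R : Type) (idx : R) (op : Monoid.com_law idx)
    (B : {set 'rV['Z_2]_(1 + n)}) (F : 'rV['Z_2]_(1 + n) -> R) :
  \big[op/idx]_(v in B) F v =
  op (\big[op/idx]_(x in layer 0%R B) F (row_mx 0%:M%R x))
     (\big[op/idx]_(x in layer 1%R B) F (row_mx 1%:M%R x)).
Proof.
rewrite (reindex (fun p : 'Z_2 * 'rV['Z_2]_n => row_mx p.1%:M%R p.2)) /=; last first.
  exists (fun v => (lsubmx v ord0 ord0, rsubmx v)) => [[c x] _ | v _] /=.
    by rewrite row_mxKl row_mxKr mxE eqxx mulr1n.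
  by rewrite -mx11_scalar hsubmxK.
rewrite -(pair_big_dep xpredT (fun c x => row_mx c%:M%R x \in B)
           (fun c x => F (row_mx c%:M%R x))) /=.
rewrite big_ord_recl big_ord1 (_ : lift ord0 ord0 = 1%R); last exact: val_inj.
by congr (op _ _); apply: eq_bigl => x; rewrite inE.
Qed.

Lemma card_layers (B : {set 'rV['Z_2]_(1 + n)}) : #|B| = #|layer 0%R B| + #|layer 1%R B|.
Proof. by rewrite -sum1_card big_layers !sum1_card. Qed.

(** In the first coordinate, layer 0 contributes nothing and each element of layer 1 contributes
    1. *)
Lemma sum_layers (B : {set 'rV['Z_2]_(1 + n)}) :
  (\sum_(v in B) v = row_mx (#|layer 1 B|%:R)%:M
     (\sum_(x in layer 0 B) x + \sum_(x in layer 1 B) x))%R.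
Proof.
have sumE c (A : {set 'rV['Z_2]_n}) :
    (\sum_(x in A) row_mx c%:M x =
     row_mx (c *+ #|A|)%:M (\sum_(x in A) x) :> 'rV['Z_2]_(1 + n))%R.
  rewrite -sumr_const raddf_sum.
  by elim/big_rec3: _ => [|x u v w _ ->]; rewrite ?row_mx0 ?add_row_mx.
by rewrite big_layers !sumE /= add_row_mx mul0rn raddf0 add0r.
Qed.

Lemma layer_two_layers c A : layer c (two_layers A) = A.
Proof. by apply/setP => x; rewrite !inE row_mxKr. Qed.

Lemma layerS c (B C : {set 'rV['Z_2]_(1 + n)}) :
  B \subset C -> layer c B \subset layer c C.
Proof. by move/subsetP => sBC; apply/subsetP => x; rewrite !inE; apply: sBC. Qed.

Lemma zero_sum_free_two_layers m A : odd m ->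
  zero_sum_free (evens_upto m) A ->
  zero_sum_free (pred1 (2 * m)) (two_layers A).
Proof.
move=> odd_m /forallP freeA; apply/forallP => B; apply/implyP.
case/andP => sBA /eqP cardB; rewrite sum_layers.
have sLA c : layer c B \subset A by rewrite -(layer_two_layers c A) layerS.
have := card_symmdiff (layer 0%R B) (layer 1%R B).
rewrite -card_layers cardB; set T := _ :|: _ => cardT.
have sTA : T \subset A by rewrite subUset !(subset_trans (subsetDl _ _)).
apply/eqP; rewrite -(row_mx0 _ 1 1 n) => /eq_row_mx[sum1 sum2].
have T0 : T = set0.
  apply/eqP; rewrite -cards_eq0; apply: contraT => T_neq0.
  have := freeA T; rewrite sTA /= sum_symmdiffZ2 sum2 eqxx implybF !inE.
  (* From [t + 2 * k = 2 * m] and [t != 0], the size [t] is one of 2, 4, ..., 2m. *)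
  by case/negP; move: cardT T_neq0; move: #|T| #|_ :&: _| => t k; clear; lia.
have eqL : layer 0%R B = layer 1%R B.
  apply/eqP; rewrite eqEsubset -!setD_eq0 -!subset0.
  by rewrite -T0 subsetUl subsetUr.
move/matrixP/(_ ord0 ord0)/eqP: sum1; rewrite !mxE eqxx mulr1n.
have -> : #|layer 1%R B| = m by have := card_layers B; rewrite eqL cardB; lia.
by rewrite natr_Z2 odd_m.
Qed.

Lemma card_two_layers A : #|two_layers A| = 2 * #|A|.
Proof. by rewrite card_layers !layer_two_layers mul2n addnn. Qed.

Lemma sum_two_layers (A : {set 'rV['Z_2]_n}) :
  ~~ odd #|A| -> (\sum_(v in two_layers A) v = 0)%R.
Proof.
move=> evA; rewrite sum_layers !layer_two_layers addZ2rr.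
by rewrite natr_Z2 (negbTE evA) raddf0 row_mx0.
Qed.

End Layers.

(** The complement in [A] of a zero-sum subset of size [#|A| - k] again has sum zero; its size is
    [k] because [k <= #|A|]. *)
Lemma zero_sum_free_compl d k (A : {set 'rV['Z_2]_d}) :
  (\sum_(x in A) x = 0)%R -> k <= #|A| ->
  zero_sum_free (pred1 k) A -> zero_sum_free (pred1 (#|A| - k)) A.
Proof.
move=> sumA le_kA /forallP freeA; apply/forallP => B; apply/implyP.
case/andP => sBA /eqP cardB; apply/eqP => sumB.
have := freeA (A :\: B); rewrite subsetDl inE cardsDS // cardB subKn // eqxx /=.
by move: sumA; rewrite (big_setID B) (setIidPr sBA) /= sumB add0r => ->; rewrite eqxx.
Qed.

Lemma zero_sum_freeS W d (A B : {set 'rV['Z_2]_d}) :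
  B \subset A -> zero_sum_free W A -> zero_sum_free W B.
Proof.
move=> sBA /forallP freeA; apply/forallP => C; apply/implyP => /andP[sCB WC].
by have := freeA C; rewrite (subset_trans sCB sBA) WC.
Qed.

Lemma leq_beta W d (A : {set 'rV['Z_2]_d}) : zero_sum_free W A -> #|A| <= beta W d.
Proof. by move=> freeA; apply: leq_bigmax_cond. Qed.

(** Since [0 \notin W], the empty set is admissible, so the maximum is attained and is not a default
    value. *)
Lemma beta_witness (W : {pred nat}) d : 0 \notin W ->
  exists2 A : {set 'rV['Z_2]_d}, zero_sum_free W A & #|A| = beta W d.
Proof.
move=> W0; have free0 : zero_sum_free W (set0 : {set 'rV['Z_2]_d}).
  apply/forallP => B; apply/implyP; rewrite subset0 => /andP[/eqP->].
  by rewrite cards0 (negbTE W0).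
rewrite /beta (bigmax_eq_arg set0) //.
by case: arg_maxnP => // A freeA _; exists A.
Qed.

Theorem theorem5 (m d : nat) (hm : odd m) (hd : 2 <= d) :
  2 * beta (evens_upto m) (d - 1) <= beta (pred1 (2 * m)) d /\
  (forall b : nat, ~~ odd b -> m < b -> b <= beta (evens_upto m) (d - 1) ->
     2 * b <= beta (pred1 (2 * b - 2 * m)) d).
Proof.
case: d hd => // n _; rewrite subn1 /=.
have [//|A freeA cardA] := @beta_witness (evens_upto m) n.
split=> [|b even_b lt_mb]; rewrite -cardA.
  by rewrite -card_two_layers leq_beta // zero_sum_free_two_layers.
(* The maximal set [A] may have more than [b] elements; shrink it to a subset [A0] of exactly [b],
   whose even size makes its two layers sum to zero. *)
case/card_geqP => s [uniq_s size_s sub_s].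
pose A0 := [set x in s].
have cardA0 : #|A0| = b by rewrite cardsE (card_uniqP uniq_s).
have sA0A : A0 \subset A by apply/subsetP => x; rewrite inE; apply: sub_s.
rewrite -cardA0 -card_two_layers.
apply/leq_beta/zero_sum_free_compl.
- by rewrite sum_two_layers // cardA0.
- by rewrite card_two_layers cardA0 leq_mul2l ltnW.
- exact/zero_sum_free_two_layers/(zero_sum_freeS sA0A).
Qed.
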